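(* Let $p\geq 1$, $r\geq 1$ and $n\geq 1$ be integers. Then the O-Fibonacci $(p,r)$-cube $O\Gamma^{(p,r)}_{n}$ is a non-trivial Cartesian product graph (i.e. $O\Gamma^{(p,r)}_{n}\cong G_1\Box G_2$ for some graphs $G_1,G_2$ each having at least two vertices) if and only if $p=1$ and $r\geq n\geq 2$.
   Context: For positive integers $p,r,n$, a binary word $a_1a_2\ldots a_n$ is an O-Fibonacci $(p,r)$-word if (1) between any two $1$s there are at least $p-1$ zeros (i.e. if $a_i=1$ then $a_{i+1}=\dots=a_{i+p-1}=0$), and (2) there are at most $r$ ''consecutive'' $1$s, where two $1$s are called consecutive when exactly $p-1$ zeros separate them; equivalently the word contains at most $r$ consecutive copies of $10^{p-1}$, i.e. it does not contain the factor $(10^{p-1})^{r}1$. The O-Fibonacci $(p,r)$-cube $O\Gamma^{(p,r)}_{n}$ is the subgraph of the hypercube $Q_n$ induced on the set of all O-Fibonacci $(p,r)$-words of length $n$; two words are adjacent iff they differ in exactly one coordinate. $G\Box H$ denotes the Cartesian product of graphs: vertex set $V(G)\times V(H)$, with $(g,h)\sim(g',h')$ iff ($g=g'$ and $hh'\in E(H)$) or ($h=h'$ and $gg'\in E(G)$). *)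

(* Defs.v *)
From mathcomp Require Import all_boot.

Set Implicit Arguments.
Unset Strict Implicit.
Unset Printing Implicit Defensive.

Record sgraph := SGraph {
  vertex :> finType;
  adj : rel vertex;
  adj_sym : symmetric adj;
  adj_irr : irreflexive adj
}.

Definition isomorphic (G H : sgraph) : Prop :=
  exists2 f : G -> H, bijective f & forall x y : G, adj (f x) (f y) = adj x y.

Section Induced.
Variables (G : sgraph) (P : pred G).

Definition induced_adj : rel {x : G | P x} := fun x y => adj (val x) (val y).

Lemma induced_adj_sym : symmetric induced_adj.
Proof. by move=> x y; apply: adj_sym. Qed.

Lemma induced_adj_irr : irreflexive induced_adj.
Proof. by move=> x; apply: adj_irr. Qed.

Definition induced : sgraph := SGraph induced_adj_sym induced_adj_irr.
End Induced.

Section CartesianProduct.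
Variables G H : sgraph.

Definition cart_adj : rel (G * H) := fun u v =>
  (u.1 == v.1) && adj u.2 v.2 || (u.2 == v.2) && adj u.1 v.1.

Lemma cart_adj_sym : symmetric cart_adj.
Proof.
move=> u v; rewrite /cart_adj (adj_sym u.1) (adj_sym u.2).
by rewrite (eq_sym u.1) (eq_sym u.2).
Qed.

Lemma cart_adj_irr : irreflexive cart_adj.
Proof. by move=> u; rewrite /cart_adj !adj_irr !andbF. Qed.

Definition cart_prod : sgraph := SGraph cart_adj_sym cart_adj_irr.
End CartesianProduct.

Definition nontrivial_cart_prod (G : sgraph) : Prop :=
  exists G1 G2 : sgraph,
    [/\ 1 < #|G1|, 1 < #|G2| & isomorphic G (cart_prod G1 G2)].

Section Hypercube.
Variable n : nat.

Definition cube_adj : rel (n.-tuple bool) := fun u v =>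
  #|[set i : 'I_n | tnth u i != tnth v i]| == 1.

Lemma cube_adj_sym : symmetric cube_adj.
Proof.
move=> u v; rewrite /cube_adj; congr (_ == _); apply: eq_card => i.
by rewrite !inE eq_sym.
Qed.

Lemma cube_adj_irr : irreflexive cube_adj.
Proof.
move=> u; rewrite /cube_adj (_ : [set _ | _] = set0) ?cards0 //.
by apply/setP=> i; rewrite !inE eqxx.
Qed.

Definition hypercube : sgraph := SGraph cube_adj_sym cube_adj_irr.
End Hypercube.

(* The second conjunct forbids the factor (1 0^(p-1))^r 1, i.e. r + 1 ones
   such that exactly p - 1 zeros separate each one from the next. Positions
   i + 1, ..., i + p - 1 that exceed the length of w carry no constraint. *)
Definition ofib_word (p r n : nat) (w : n.-tuple bool) : bool :=
  [forall i : 'I_n, forall j : 'I_n,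
     tnth w i && (i < j < i + p) ==> ~~ tnth w j]
  && ~~ infix (flatten (nseq r (true :: nseq p.-1 false)) ++ [:: true]) w.

Definition ofib_cube (p r n : nat) : sgraph :=
  @induced (hypercube n) (@ofib_word p r n).

(* Main.v *)
(** The Fibonacci words, read as subsets of the coordinates, form a simplicial
complex containing all singletons. If a graph of this kind factors as
[G1 [] G2], each coordinate [i] is coloured by the factor in which the edge
from [0] to [e_i] lies. Completing squares one at a time shows that the union
of a face of the first colour and a face of the second colour is again a face,
and that both colours occur when both factors are nontrivial. Hence no minimal
nonface is bicoloured. Some two neighbouring positions [k], [k + 1] have
different colours; for [p >= 2] they form a minimal nonface, and for [p = 1],
[r < n] some window of [r + 1] consecutive positions containing both is one.
In the remaining case the graph is the whole hypercube. *)

Require Import Defs.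
From mathcomp Require Import all_boot zify.

Set Implicit Arguments.
Unset Strict Implicit.
Unset Printing Implicit Defensive.

(** * Cartesian factorisations of the graph on the faces of a simplicial complex *)

Section SetGraphFactors.
Variable T : finType.
Implicit Types A B C X : {set T}.

Definition differ1 A B := #|[set i | (i \in A) != (i \in B)]| == 1.

Lemma differ1P A B :
  reflect (exists x, forall z, (z \in B) = (z \in A) (+) (z == x))
          (differ1 A B).
Proof.
apply: (iffP cards1P) => -[x Hx]; exists x.
  move=> z; move/setP/(_ z): Hx; rewrite !inE.
  by case: (z \in A); case: (z \in B) => //= <-.
by apply/setP=> z; rewrite !inE Hx; case: (z \in A); case: (z == x).
Qed.

Lemma differ1_setD1 A i : i \in A -> differ1 A (A :\ i).
Proof.
move=> iA; apply/differ1P; exists i => z; rewrite !inE.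
by case: eqP => [->|_]; rewrite ?iA ?addbF.
Qed.

(** Two vertices of a hypercube at distance two have just two common neighbours: here one is [C],
    the other the far corner of the square. *)
Lemma differ1_square C X i j :
  i != j -> i \notin C -> j \notin C ->
  differ1 X (i |: C) -> differ1 X (j |: C) -> X != C -> X = i |: (j |: C).
Proof.
move=> ij iC jC /differ1P[x Hx] /differ1P[y Hy] XC.
have Xx z : (z \in X) = (z \in i |: C) (+) (z == x).
  by rewrite Hx -addbA addbb addbF.
have xi : x != i.
  apply: contraNneq XC => xi; apply/eqP/setP=> z.
  rewrite Xx xi !inE; case: eqP => [->|_]; last by rewrite addbF.
  by rewrite (negbTE iC).
have xj : x = j.
  apply/eqP; apply: contraNT xi => xj; have:= Hy j; have:= Hy i.
  rewrite !Xx !inE !eqxx (negbTE iC) (negbTE jC) (negbTE ij) (eq_sym j i).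
  rewrite (negbTE ij) (eq_sym j x) (negbTE xj) (eq_sym i x) /=.
  by case: eqP => //= _; case: (i =P y) => // <-; rewrite eq_sym (negbTE ij).
apply/setP=> z; rewrite Xx xj !inE; case: (z =P j) => [->|_].
  by rewrite (negbTE jC) eq_sym (negbTE ij).
by rewrite addbF.
Qed.

Variable D : pred {set T}.
Hypothesis D_sub : forall A B, A \subset B -> D B -> D A.

(** An isomorphism from the graph on the faces, written as a total function on sets; its values
    outside [D] are irrelevant. *)
Definition labelling (G1 G2 : sgraph) (h : {set T} -> G1 * G2) :=
  [/\ {in D &, injective h}, forall y, exists2 A, D A & h A = y
    & {in D &, forall A B,
        adj (h A : cart_prod G1 G2) (h B) = differ1 A B}].

Lemma labelling_swap G1 G2 h :
  @labelling G1 G2 h -> @labelling G2 G1 (fun A => ((h A).2, (h A).1)).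
Proof.
case=> h_inj h_onto h_adj; split.
- move=> A B DA DB [e2 e1]; apply: h_inj => //.
  by rewrite [h A]surjective_pairing e1 e2 -surjective_pairing.
- by case=> y x; have [A DA hA] := h_onto (x, y); exists A; rewrite // hA.
- by move=> A B DA DB; rewrite -h_adj // /= /cart_adj /= orbC.
Qed.

(** The first colour class: edges from the empty set to these singletons lie in the first factor. *)
Definition dir1 (G1 G2 : sgraph) (h : {set T} -> G1 * G2) :=
  [set i | (h [set i]).2 == (h set0).2].

(** By induction every [A :\ k] has the base second coordinate. If [A] did not, its edges to
    [A :\ i] and [A :\ j] would both move in the second factor, so both neighbours would share the
    first coordinate of [A], against injectivity. *)
Lemma dir1_const G1 G2 h A : @labelling G1 G2 h ->
  D A -> A \subset dir1 h -> (h A).2 = (h set0).2.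
Proof.
case=> h_inj _ h_adj; have [m] := ubnP #|A|.
elim: m A => // m IHm A ltAm DA sAI.
have [->//|[i iA]] := set_0Vmem A.
have [A0|[j]] := set_0Vmem (A :\ i).
  have {}A0 : A = [set i] by rewrite -(setD1K iA) A0 setU0.
  by move: sAI; rewrite A0 sub1set inE => /eqP.
rewrite !inE => /andP[ji jA].
have IH k : k \in A -> D (A :\ k) /\ (h (A :\ k)).2 = (h set0).2.
  move=> kA; have DAk : D (A :\ k) by apply: D_sub DA; apply: subD1set.
  split=> //; apply: IHm => //; last exact: subset_trans (subD1set _ _) sAI.
  by move: ltAm; rewrite (cardsD1 k) kA.
have [[Di hi] [Dj hj]] := (IH i iA, IH j jA).
apply/eqP; apply: contraT => neq.
have same1 k : k \in A -> (h A).1 = (h (A :\ k)).1.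
  move=> kA; have [Dk hk] := IH k kA.
  have:= h_adj A (A :\ k) DA Dk; rewrite differ1_setD1 //= /cart_adj hk.
  by rewrite (negbTE neq) orbF => /andP[/eqP].
have: A :\ i = A :\ j.
  apply: h_inj => //; rewrite [h (A :\ i)]surjective_pairing hi -hj -same1 //.
  by rewrite (same1 j) // -surjective_pairing.
by move/setP/(_ j); rewrite !inE eqxx ji jA.
Qed.

(** Induction on [#|A| + #|B|]: three corners of a square are faces with known labels, and
    surjectivity supplies the fourth, which can only be [A :|: B]. *)
Lemma dir_join G1 G2 h A B : @labelling G1 G2 h ->
  let h' := fun A => ((h A).2, (h A).1) in
  D A -> D B -> A \subset dir1 h -> B \subset dir1 h' ->
  D (A :|: B) /\ h (A :|: B) = ((h A).1, (h B).2).
Proof.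
move=> lab h'; have lab' := labelling_swap lab.
have [h_inj h_onto h_adj] := lab.
have [m] := ubnP (#|A| + #|B|); elim: m A B => // m IHm A B ltm DA DB sA sB.
have hA2 := dir1_const lab DA sA; have /= hB1 := dir1_const lab' DB sB.
have [A0|[i iA]] := set_0Vmem A.
  by rewrite A0 set0U -hB1 /= -surjective_pairing.
have [B0|[j jB]] := set_0Vmem B.
  by rewrite B0 setU0 -hA2 /= -surjective_pairing.
(* A common element [k] would give [[set k]] and [set0] the same label. *)
have disj k : k \in A -> k \notin B.
  move=> kA; apply/negP=> kB; have /eqP: [set k] = set0.
    apply: h_inj; first by apply: D_sub DA; rewrite sub1set.
      by apply: D_sub DA; apply: sub0set.
    have:= subsetP sA _ kA; have:= subsetP sB _ kB; rewrite !inE /=.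
    by move=> /eqP e1 /eqP e2; rewrite [LHS]surjective_pairing e1 e2;
      case: (h set0).
  by rewrite -cards_eq0 cards1.
have ij : i != j by apply: contraTneq jB => <-; apply: disj.
have iB := disj i iA; have jA : j \notin A by apply: contraL jB; apply: disj.
set A' := A :\ i; set B' := B :\ j.
have sA'A : A' \subset A by apply: subD1set.
have sB'B : B' \subset B by apply: subD1set.
have DA' : D A' by apply: D_sub DA.
have DB' : D B' by apply: D_sub DB.
have sA' := subset_trans sA'A sA; have sB' := subset_trans sB'B sB.
have hA'2 := dir1_const lab DA' sA'; have /= hB'1 := dir1_const lab' DB' sB'.
have cA : #|A| = #|A'|.+1 by rewrite (cardsD1 i) iA.
have cB : #|B| = #|B'|.+1 by rewrite (cardsD1 j) jB.
have [DAB' hAB'] : D (A :|: B') /\ h (A :|: B') = ((h A).1, (h B').2).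
  by apply: IHm => //; move: ltm; rewrite cB addnS.
have [DA'B hA'B] : D (A' :|: B) /\ h (A' :|: B) = ((h A').1, (h B).2).
  by apply: IHm => //; move: ltm; rewrite cA addSn.
have [DA'B' hA'B'] : D (A' :|: B') /\ h (A' :|: B') = ((h A').1, (h B').2).
  by apply: IHm => //; move: ltm; rewrite cA cB addSn addnS => /ltnW.
have adjA : adj (h A).1 (h A').1.
  have:= h_adj _ _ DA DA'; rewrite differ1_setD1 //= /cart_adj hA2 hA'2.
  by rewrite adj_irr andbF eqxx.
have adjB : adj (h B).2 (h B').2.
  have:= h_adj _ _ DB DB'; rewrite differ1_setD1 //= /cart_adj.
  by rewrite hB1 hB'1 adj_irr andbF orbF eqxx.
have [X DX hX] := h_onto ((h A).1, (h B).2).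
suff -> : A :|: B = X by [].
have eAB' : i |: (A' :|: B') = A :|: B' by rewrite setUA setD1K.
have eA'B : j |: (A' :|: B') = A' :|: B by rewrite setUCA setD1K.
rewrite (@differ1_square (A' :|: B') X i j) //.
- by rewrite eA'B setUA setD1K.
- by rewrite !inE eqxx (negbTE iB) andbF.
- by rewrite !inE eqxx (negbTE jA) andbF.
- by rewrite eAB' -h_adj // hX hAB' /= /cart_adj /= eqxx adjB.
- by rewrite eA'B -h_adj // hX hA'B /= /cart_adj /= eqxx adjA orbT.
(* The first coordinates of [X] and of the opposite corner are adjacent, hence distinct. *)
apply: contraTneq adjA => eX; move: hX; rewrite eX hA'B' => -[-> _].
by rewrite adj_irr.
Qed.

(** The witness is [dir1 h]. If one colour were missing, [dir1_const] would make a coordinate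
    constant on all faces, against surjectivity onto a factor with two vertices. *)
Lemma labelling_colouring G1 G2 h : @labelling G1 G2 h ->
  1 < #|G1| -> 1 < #|G2| -> (forall i, D [set i]) ->
  exists I : {set T}, [/\ I != set0, I != setT &
    forall A, D (A :&: I) -> D (A :\: I) -> D A].
Proof.
move=> lab c1 c2 D1; have lab' := labelling_swap lab.
set h' := (fun A => _) in lab'.
have other (G : sgraph) (a : G) : 1 < #|G| -> exists b, b != a.
  by case/card_gt1P=> x [y [_ _ xy]]; have [<-|] := eqVneq x a;
    [exists y; rewrite eq_sym | exists x].
have dirU i : (i \in dir1 h) || (i \in dir1 h').
  have [_ _ h_adj] := lab.
  have D0 : D set0 by apply: D_sub (D1 i); apply: sub0set.
  have := h_adj [set i] set0 (D1 i) D0.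
  have -> : set0 = [set i] :\ i by rewrite setDv.
  rewrite differ1_setD1 ?set11 // setDv !inE /= /cart_adj.
  by case/orP=> /andP[-> _]; rewrite ?orbT.
exists (dir1 h); split.
- have [x] := other G1 (h set0).1 c1; apply: contraNneq => I0.
  have [_ /(_ (x, (h set0).2))[A DA hA] _] := lab.
  have := dir1_const lab' DA; rewrite /= hA /= => -> //.
  by apply/subsetP=> i _; have:= dirU i; rewrite I0 inE.
- have [x] := other G2 (h set0).2 c2; apply: contraNneq => I0.
  have [_ /(_ ((h set0).1, x))[A DA hA] _] := lab.
  by have := dir1_const lab DA; rewrite /= hA /= => -> //; rewrite I0 subsetT.
move=> A DI DJ; rewrite -(setID A (dir1 h)).
case: (dir_join lab DI DJ) => //; first exact: subsetIr.
apply/subsetP=> i; rewrite inE => /andP[iI _].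
by have:= dirU i; rewrite (negbTE iI).
Qed.

End SetGraphFactors.

(** * Words as sets of positions *)

Section Words.
Variable n : nat.
Implicit Types (w : n.-tuple bool) (A : {set 'I_n}).

Definition support w : {set 'I_n} := [set i | tnth w i].
Definition word A : n.-tuple bool := [tuple i \in A | i < n].

Lemma wordK : cancel word support.
Proof. by move=> A; apply/setP=> i; rewrite inE tnth_mktuple. Qed.

Lemma supportK : cancel support word.
Proof. by move=> w; apply: eq_from_tnth => i; rewrite tnth_mktuple inE. Qed.

Lemma cube_adj_support u v : cube_adj u v = differ1 (support u) (support v).
Proof.
by rewrite /cube_adj /differ1; congr (_ == _); apply: eq_card => i; rewrite !inE.
Qed.

Lemma nth_word A (i : 'I_n) : nth false (word A) i = (i \in A).
Proof. by rewrite -tnth_nth tnth_mktuple. Qed.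

Lemma count_word A : count id (word A) = #|A|.
Proof.
rewrite -sum1_card -sum1_count big_tuple /=.
by apply: eq_bigl => i; rewrite tnth_mktuple.
Qed.

End Words.

(** * The forbidden factor *)

Lemma infix_nthP (s t : seq bool) :
  reflect (exists2 k, k + size s <= size t &
             forall i, i < size s -> nth false t (k + i) = nth false s i)
          (infix s t).
Proof.
apply: (iffP (@infixP _ s t)) => [[u [v ->]]|[k kt Hk]].
  exists (size u); first by rewrite !size_cat leq_add2l leq_addr.
  by move=> i lti; rewrite nth_cat ltnNge leq_addr /= addKn nth_cat lti.
exists (take k t), (drop (size s) (drop k t)).
suff -> : s = take (size s) (drop k t) by rewrite size_takel ?cat_take_drop //
  size_drop; lia.
apply: (@eq_from_nth _ false) => [|i lti].
  by rewrite size_takel // size_drop; lia.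
by rewrite nth_take // nth_drop Hk.
Qed.

Definition run p r := flatten (nseq r (true :: nseq p.-1 false)) ++ [:: true].

Lemma runS p r : run p r.+1 = (true :: nseq p.-1 false) ++ run p r.
Proof. by rewrite /run /= -catA. Qed.

Lemma count_run p r : count id (run p r) = r.+1.
Proof.
by elim: r => // r IHr; rewrite runS count_cat IHr /= count_nseq.
Qed.

Lemma infix_run_count p r t : infix (run p r) t -> r < count id t.
Proof.
by case/infixP=> u [v ->]; rewrite count_cat (count_cat id (run p r)) count_run; lia.
Qed.

Lemma run1 r : run 1 r = nseq r.+1 true.
Proof. by elim: r => // r IHr; rewrite runS IHr. Qed.

(** A position in the first block looks back to the leading 1 of that block; later ones follow by
    shifting by [p]. *)
Lemma run_gap p r i : 0 < p -> i < size (run p r) ->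
  exists j, [/\ j <= i, i < j + p & nth false (run p r) j].
Proof.
move=> p0; elim: r i => [|r IHr] i; first by case: i => // _; exists 0.
rewrite runS size_cat /= size_nseq prednK // => lti.
have [ip|pi] := ltnP i p; first by exists 0.
have [|j [ji ij Hj]] := IHr (i - p); first by lia.
exists (p + j); split; [lia | lia |].
rewrite -cat_cons nth_cat /= size_nseq prednK // ltnNge leq_addr /=.
by rewrite addKn.
Qed.

(** * The complex of Fibonacci words *)

Section OFibComplex.
Variables p r n : nat.
Hypothesis hp : 0 < p.
Implicit Types A B : {set 'I_n}.

Definition ofib_face (A : {set 'I_n}) := ofib_word p r (word A).

Lemma ofib_faceP A : reflect
  ((forall i j : 'I_n, i \in A -> j \in A -> i < j -> i + p <= j) /\
   ~~ infix (run p r) (word A)) (ofib_face A).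
Proof.
apply: (iffP andP) => -[spaced ?]; split=> //.
  move=> i j iA jA ij; have /forallP/(_ i)/forallP/(_ j) := spaced.
  by rewrite !tnth_mktuple iA jA ij /= implybF -leqNgt.
apply/forallP=> i; apply/forallP=> j; rewrite !tnth_mktuple.
apply/implyP=> /andP[iA /andP[ij]]; apply: contraL => jA.
by rewrite -leqNgt; apply: spaced.
Qed.

(* Inside a run every 0 is within distance p of an earlier 1, so an added 1
   either violates the spacing or leaves the run intact. *)
Lemma ofib_face_sub A B : A \subset B -> ofib_face B -> ofib_face A.
Proof.
move=> /subsetP sAB /ofib_faceP[spaced norun]; apply/ofib_faceP; split.
  by move=> i j iA jA; apply: spaced; apply: sAB.
apply: contra norun => /infix_nthP[k]; rewrite !size_tuple => kn Hk.
apply/infix_nthP; exists k; rewrite ?size_tuple // => i lti.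
have lt_kn m : m < size (run p r) -> k + m < n by lia.
rewrite -Hk //; rewrite -[k + i]/(val (Ordinal (lt_kn i lti))) !nth_word.
apply/idP/idP=> [iB|]; last exact: sAB.
have [j [ji ij Rj]] := run_gap hp lti.
have ltj : j < size (run p r) by lia.
have jA : Ordinal (lt_kn j ltj) \in A by rewrite -nth_word /= Hk.
have [jei|ltji] := eqVneq j i.
  suff -> : Ordinal (lt_kn i lti) = Ordinal (lt_kn j ltj) by [].
  by apply: val_inj; rewrite /= jei.
by have /= := spaced _ _ (sAB _ jA) iB; lia.
Qed.

(** A run has [r + 1] ones, too many for such a set. *)
Lemma ofib_face_small A : #|A| <= r ->
  (forall i j : 'I_n, i \in A -> j \in A -> i < j -> i + p <= j) ->
  ofib_face A.
Proof.
move=> cA spaced; apply/ofib_faceP; split=> //.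
by apply/negP=> /infix_run_count; rewrite count_word ltnNge cA.
Qed.

Lemma ofib_labelling (G1 G2 : sgraph) :
  isomorphic (ofib_cube p r n) (cart_prod G1 G2) ->
  exists h, @labelling _ ofib_face G1 G2 h.
Proof.
case=> f [g fK gK] f_adj.
have face0 : ofib_word p r (word (set0 : {set 'I_n})).
  apply/ofib_faceP; split; first by move=> i j; rewrite inE.
  by apply/negP=> /infix_run_count; rewrite count_word cards0.
(* Nonfaces are sent to the zero word by default, which a labelling ignores. *)
pose e A : ofib_cube p r n := insubd (Sub _ face0) (word A).
have eE A : ofib_face A -> val (e A) = word A by move=> FA; rewrite insubdK.
exists (fun A => f (e A)); split.
- move=> A B FA FB /(can_inj fK)/(congr1 val); rewrite !eE //.
  exact: (can_inj (@wordK n)).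
- move=> y; exists (support (val (g y))).
    by rewrite /ofib_face supportK; exact: valP (g y).
  rewrite -[RHS]gK; congr f; apply: val_inj; rewrite eE ?supportK //.
  by rewrite /ofib_face supportK; exact: valP (g y).
- move=> A B FA FB; rewrite f_adj /= /induced_adj /= !eE //.
  by rewrite cube_adj_support !wordK.
Qed.

End OFibComplex.

(** * Bicoloured minimal nonfaces *)

(** Without a change, induction along the positions gives all of them the colour of [ord0]. *)
Lemma colour_change n (I : {set 'I_n}) : I != set0 -> I != setT ->
  exists i j : 'I_n, j = i.+1 :> nat /\ (i \in I) != (j \in I).
Proof.
case: n I => [|n] I; first by case/set0Pn=> -[].
move=> /set0Pn[i0 i0I] IT.
suff /existsP[i /existsP[j /andP[/eqP ij neq]]] :
    [exists i : 'I_n.+1, exists j : 'I_n.+1,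
      (j == i.+1 :> nat) && ((i \in I) != (j \in I))] by exists i, j.
apply: contraNT IT => none.
have const (i : 'I_n.+1) : (i \in I) = (ord0 \in I).
  case: i => i; elim: i => [|i IHi] lti.
    by congr (_ \in I); apply: val_inj.
  rewrite -(IHi (ltnW lti)); apply/esym/eqP; apply: contraNT none => neq.
  apply/existsP; exists (Ordinal (ltnW lti)); apply/existsP.
  by exists (Ordinal lti); rewrite eqxx.
by apply/eqP/setP=> i; rewrite inE const -(const i0).
Qed.

(** Each colour occurs in [A], so dropping either one leaves fewer elements. Both parts of a
    bicoloured minimal nonface are thus faces. *)
Lemma bicoloured_card (T : finType) (A I : {set T}) x y :
  x \in A -> y \in A -> (x \in I) != (y \in I) ->
  #|A :&: I| < #|A| /\ #|A :\: I| < #|A|.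
Proof.
move=> xA yA neq; rewrite -(cardsID I A) -addn1 leq_add2l card_gt0.
rewrite -[in X in _ /\ X]add1n leq_add2r card_gt0.
by split; apply/set0Pn; case xI: (x \in I) neq; case yI: (y \in I) => // _;
  [exists y | exists x | exists x | exists y]; rewrite !inE ?xI ?yI ?xA ?yA.
Qed.

Lemma word_window n s m : s + m <= n ->
  word [set k : 'I_n | s <= k < s + m] =
    nseq s false ++ nseq m true ++ nseq (n - (s + m)) false :> seq bool.
Proof.
move=> le_n; apply: (@eq_from_nth _ false) => [|k].
  by rewrite size_tuple !size_cat !size_nseq; lia.
rewrite size_tuple => ltk; rewrite -[k]/(val (Ordinal ltk)) nth_word inE /=.
rewrite !nth_cat !size_nseq !nth_nseq; case: (ltnP k s) => // sk.
rewrite ltn_subLR //; case: ltnP => // _.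
by case: ifP.
Qed.

Lemma ofib_not_prod p r n : 0 < p -> 0 < r ->
  nontrivial_cart_prod (ofib_cube p r n) -> p = 1 /\ n <= r /\ 1 < n.
Proof.
move=> hp hr [G1 [G2 [c1 c2 /ofib_labelling[h lab]]]].
have face_le1 (A : {set 'I_n}) : #|A| <= 1 -> ofib_face p r A.
  move=> A1; apply: ofib_face_small => //; first exact: leq_trans A1 hr.
  by move=> i j iA jA; rewrite (card_le1_eqP A1 i j iA jA) ltnn.
have [|I [I0 IT joinI]] := labelling_colouring (ofib_face_sub hp) lab c1 c2.
  by move=> i; apply: face_le1; rewrite cards1.
have [i [j [ij neq]]] := colour_change I0 IT.
have n1 : 1 < n by have := ltn_ord j; lia.
have p1 : p = 1.
  apply/eqP; rewrite eqn_leq hp andbT leqNgt; apply/negP=> p2.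
  (* Each colour takes a single position of this pair, so the parts are faces and can be joined; yet
     the pair violates the spacing. *)
  have: ofib_face p r [set i; j].
    have [] := bicoloured_card (set21 i j) (set22 i j) neq.
    rewrite cards2 ltnS => cI cD.
    by apply: joinI; apply: face_le1; apply: leq_trans (leq_b1 _); eassumption.
  case/ofib_faceP=> /(_ i j); rewrite set21 set22 => /(_ isT isT).
  by lia.
split=> //; split=> //; rewrite leqNgt; apply/negP=> rn.
(* The window of length [r + 1] starts at [i], or ends at the last position if it would otherwise
   leave the word; either way it contains [i] and [i + 1]. *)
pose s := minn i (n - r.+1).
have le_n : s + r.+1 <= n by lia.
have wE := word_window le_n; set W := [set k | _] in wE.
have cW : #|W| <= r.+1.
  by rewrite -count_word wE !count_cat !count_nseq; lia.
have face_lt (A : {set 'I_n}) : #|A| < #|W| -> ofib_face p r A.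
  move=> ltA; apply: ofib_face_small => //; first by lia.
  by rewrite p1 => k l _ _; rewrite addn1.
have : ofib_face p r W.
  have [||cI cD] := bicoloured_card (A := W) _ _ neq.
  - by rewrite inE; have := ltn_ord j; lia.
  - by rewrite inE; have := ltn_ord j; lia.
  by apply: joinI; apply: face_lt.
(* For [p = 1] the [r + 1] ones of the window are themselves the forbidden factor. *)
case/ofib_faceP=> _ /negP[]; apply/(@infixP bool).
by rewrite wE p1 run1; do 2!eexists.
Qed.

(** * The full hypercube as a product *)

Definition K2_adj : rel bool := fun x y => x != y.

Lemma K2_adj_sym : symmetric K2_adj.
Proof. by move=> x y; rewrite /K2_adj eq_sym. Qed.

Lemma K2_adj_irr : irreflexive K2_adj.
Proof. by move=> x; rewrite /K2_adj eqxx. Qed.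

Definition K2 : sgraph := SGraph K2_adj_sym K2_adj_irr.

(** The Hamming distance is [(x != y) + d], with [d] the distance of the tails, and equals 1 in just
    two ways: these are the two kinds of edges in a product with [K2]. *)
Lemma cube_adj_cons n (x y : bool) (u v : n.-tuple bool) :
  cube_adj [tuple of x :: u] [tuple of y :: v] =
  (x == y) && cube_adj u v || (u == v) && (x != y).
Proof.
have uvE : (u == v) = (#|[set i | tnth u i != tnth v i]| == 0).
  rewrite cards_eq0; apply/eqP/eqP => [->|/setP e].
    by apply/setP=> i; rewrite !inE eqxx.
  by apply: eq_from_tnth => i; have := e i; rewrite !inE => /negbFE/eqP.
rewrite uvE /cube_adj; set d := #|[set i | tnth u i != _]|.
suff -> : #|[set i | tnth [tuple of x :: u] i != tnth [tuple of y :: v] i]| =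
    (x != y) + d.
  by case: (x =P y) => _ /=; rewrite ?add0n ?add1n ?eqSS ?andbT ?andbF ?orbF.
rewrite /d -!sum1_card big_mkcond big_ord_recl inE !tnth0 [in RHS]big_mkcond.
congr (_ + _).
by apply: eq_bigr => i _; rewrite !inE !tnthS.
Qed.

Lemma ofib_word_all p r n (w : n.-tuple bool) : p = 1 -> n <= r ->
  ofib_word p r w.
Proof.
move=> -> nr; rewrite -(supportK w) -/(ofib_face _ _ _).
apply: ofib_face_small => //; last by move=> i j _ _; rewrite addn1.
by apply: leq_trans nr; rewrite -[X in _ <= X]card_ord max_card.
Qed.

Lemma ofib_prod p r n : p = 1 -> n <= r -> 1 < n ->
  nontrivial_cart_prod (ofib_cube p r n).
Proof.
move=> p1; case: n => [|[|n]] // nr _.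
exists K2, (hypercube n.+1); split; first by rewrite card_bool.
  by rewrite card_tuple card_bool -{1}(expn0 2) ltn_exp2l.
pose f (w : ofib_cube p r n.+2) : cart_prod K2 (hypercube n.+1) :=
  (thead (val w), [tuple of behead (val w)]).
pose g (y : cart_prod K2 (hypercube n.+1)) : ofib_cube p r n.+2 :=
  Sub [tuple of y.1 :: y.2] (ofib_word_all _ p1 nr).
exists f.
  apply: (Bijective (g := g)) => [w|[x u]].
    by apply: val_inj; rewrite /= -tuple_eta.
  by apply/eqP; rewrite xpair_eqE theadE eqxx /= -val_eqE.
move=> u v; rewrite /= /induced_adj /= [in RHS](tuple_eta (val u)).
by rewrite [in RHS](tuple_eta (val v)) cube_adj_cons.
Qed.

Theorem theorem1p4 (p r n : nat) (hp : 1 <= p) (hr : 1 <= r) (hn : 1 <= n) :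
  nontrivial_cart_prod (ofib_cube p r n) <-> p = 1 /\ n <= r /\ 2 <= n.
Proof.
split; first exact: ofib_not_prod.
by case=> p1 [nr n2]; apply: ofib_prod.
Qed.
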